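(* Let $G$ be a hypohamiltonian graph, i.e. $G$ has no Hamiltonian cycle but $G - v$ has a Hamiltonian cycle for every vertex $v$ of $G$. Then the minimum $k \ge 0$ such that $G$ has a $k$-Unbounded Hamiltonian Cycle equals $1$.
   Context: All graphs are finite, simple, undirected and connected. A path here means a finite walk, i.e. a finite sequence of vertices $(x_1,\dots,x_\ell)$ with consecutive vertices adjacent; vertices and edges may repeat. A vertex is bounded in such a path if it appears exactly once in the sequence and unbounded if it appears more than once. A $k$-Unbounded Hamiltonian Path is a path in which every vertex of the graph appears and exactly $k$ vertices are unbounded. A $k$-Unbounded Hamiltonian Cycle is a $k$-Unbounded Hamiltonian Path whose first and last vertices $x_1$, $x_\ell$ are adjacent. Hamiltonian cycles have at least three vertices. *)

(* Defs.v *)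
From mathcomp Require Import all_boot.

Set Implicit Arguments.
Unset Strict Implicit.
Unset Printing Implicit Defensive.

Record sgraph := SGraph {
  vertex :> finType;
  edge : rel vertex;
  edge_sym : symmetric edge;
  edge_irrefl : irreflexive edge }.

Arguments edge {s}.

Definition connected_graph (G : sgraph) : Prop :=
  0 < #|G| /\ forall x y : G, connect edge x y.

Section DeleteVertex.
Variables (G : sgraph) (v : G).

Definition del_edge : rel {x : G | x != v} := relpre val edge.

Lemma del_edge_sym : symmetric del_edge.
Proof. by move=> x y; apply: edge_sym. Qed.

Lemma del_edge_irrefl : irreflexive del_edge.
Proof. by move=> x; apply: edge_irrefl. Qed.

(* The induced subgraph G - v. *)
Definition del_vertex : sgraph := SGraph del_edge_sym del_edge_irrefl.
End DeleteVertex.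

(* The length condition is needed because [cycle] accepts the empty sequence
   and, along a single edge, sequences of length two. *)
Definition hamiltonian_cycle (G : sgraph) (c : seq G) : Prop :=
  [/\ ucycle edge c, 2 < size c & forall x : G, x \in c].

Definition hamiltonian (G : sgraph) : Prop :=
  exists c : seq G, hamiltonian_cycle c.

Definition hypohamiltonian (G : sgraph) : Prop :=
  ~ hamiltonian G /\ forall v : G, hamiltonian (del_vertex v).

Definition unbounded (G : sgraph) (s : seq G) : {set G} :=
  [set v | 1 < count_mem v s].

(* The walk x_1, ..., x_l is represented by x = x_1 and p = [x_2, ..., x_l],
   so that it is nonempty and x_l = last x p. *)
Definition unbounded_ham_path (G : sgraph) (k : nat) (x : G) (p : seq G) :
    Prop :=
  [/\ path edge x p, forall v : G, v \in x :: p
    & #|unbounded (x :: p)| = k].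

Definition unbounded_ham_cycle (G : sgraph) (k : nat) (x : G) (p : seq G) :
    Prop :=
  unbounded_ham_path k x p /\ edge x (last x p).

Definition has_unbounded_ham_cycle (G : sgraph) (k : nat) : Prop :=
  exists (x : G) (p : seq G), unbounded_ham_cycle k x p.

Definition is_minimum (P : nat -> Prop) (m : nat) : Prop :=
  P m /\ forall k, P k -> m <= k.

(* Main.v *)
Require Import Defs.
From mathcomp Require Import all_boot.

(** A 0-unbounded Hamiltonian cycle visits each vertex exactly once, so on more than two vertices it
    is a Hamiltonian cycle, which [G] lacks ([unbounded0_hamiltonian]). The value 1 is attained by
    taking a Hamiltonian cycle of [G - v] and making a detour to [v] and back from a neighbour [u]
    of [v], which connectedness provides ([del_vertex_unbounded1]). *)

Lemma connect_neighbor (T : finType) (e : rel T) (x y : T) :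
  connect e x y -> x != y -> exists z, e x z.
Proof.
case/connectP=> [[|z p] /= + ->]; first by rewrite eqxx.
by case/andP=> exz _ _; exists z.
Qed.

Lemma del_vertex_ham_cycle (G : sgraph) (v : G) :
  hamiltonian (del_vertex v) ->
  exists c : seq G, [/\ cycle edge c, uniq c, 2 < size c
                      & forall x, (x \in c) = (x != v)].
Proof.
case=> c [/andP[cyc_c uniq_c] size_c cover_c].
exists (map val c); split; first by rewrite cycle_map.
- by rewrite (map_inj_uniq val_inj).
- by rewrite size_map.
move=> x; apply/mapP/idP => [[y _ ->]|xv]; first exact: (valP y).
by exists (Sub x xv : {x : G | x != v}).
Qed.

(** The bound on [#|G|] rules out a single edge, whose two ends form a 0-unbounded cycle but not a
    Hamiltonian one. *)
Lemma unbounded0_hamiltonian (G : sgraph) :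
  2 < #|G| -> has_unbounded_ham_cycle G 0 -> hamiltonian G.
Proof.
move=> G_gt2 [x [p [[path_p cover_p /eqP]]]].
rewrite cards_eq0 => /eqP unb0 adj; exists (x :: p).
have uniq_p : uniq (x :: p).
  apply: count_mem_uniq => y; rewrite cover_p.
  have := in_set0 y; rewrite -unb0 inE => /negbT; rewrite -leqNgt => le1.
  by apply/eqP; rewrite eqn_leq le1 -has_count has_pred1 cover_p.
split=> //; last first.
  apply: leq_trans G_gt2 _; rewrite -(card_uniqP uniq_p).
  by apply: subset_leq_card; apply/subsetP=> y _; apply: cover_p.
by rewrite /ucycle uniq_p /= rcons_path path_p edge_sym adj.
Qed.

(* Insert the deleted vertex [v] as a detour [u, v, u] at a neighbour [u]:
   only [u] is visited twice. *)
Lemma del_vertex_unbounded1 (G : sgraph) (v u : G) :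
  edge v u -> hamiltonian (del_vertex v) -> has_unbounded_ham_cycle G 1.
Proof.
move=> vu /del_vertex_ham_cycle[c [cyc_c uniq_c _ cover_c]].
have u_in_c : u \in c.
  by rewrite cover_c; apply: contraTneq vu => ->; rewrite edge_irrefl.
have [i q def_c] := rot_to u_in_c.
have cover_q x : (x \in u :: q) = (x != v) by rewrite -def_c mem_rot.
have uniq_q : uniq (u :: q) by rewrite -def_c rot_uniq.
have : cycle edge (u :: q) by rewrite -def_c rot_cycle.
rewrite /= rcons_path => /andP[path_q last_q].
(* The walk still ends at [last u q], so the closing edge of the old cycle closes it too. *)
exists u, [:: v, u & q]; split; last by rewrite edge_sym.
split; first by rewrite /= edge_sym vu.
  by move=> x; rewrite inE in_cons cover_q orbN orbT.
apply/eqP/cards1P; exists u; apply/setP=> x; rewrite !inE.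
have -> : count_mem x [:: u, v, u & q]
          = (u == x) + ((v == x) + count_mem x (u :: q)) by [].
(* The last two terms become [(x == v) + (x != v)], which is 1 for every [x]; the count thus exceeds
   1 exactly when [x] is [u]. *)
rewrite (count_uniq_mem _ uniq_q) cover_q !(eq_sym _ x).
have [->|_] := eqVneq x u; last by case: (x == v).
by case: (u == v).
Qed.

Theorem mainTheorem2 (G : sgraph) (G_connected : connected_graph G)
    (G_hypo : hypohamiltonian G) :
  is_minimum (has_unbounded_ham_cycle G) 1.
Proof.
case: G_connected => /card_gt0P[v _] conn; case: G_hypo => nham ham_del.
have [c [_ uniq_c size_c cover_c]] := del_vertex_ham_cycle _ _ (ham_del v).
split; last first.
  case=> // /unbounded0_hamiltonian ham; case: nham; apply: ham.
  (* The cycle of [G - v] alone supplies more than two vertices. *)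
  by apply: leq_trans size_c _; rewrite -(card_uniqP uniq_c) max_card.
(* Any vertex [w] of the cycle differs from [v], so a path from [v] to [w] starts with an edge at
   [v]. *)
have [w w_in_c] : exists w, w \in c.
  by case: c size_c {uniq_c cover_c} => // w c _; exists w; rewrite mem_head.
have vw : v != w by rewrite eq_sym -cover_c.
have [u vu] := connect_neighbor _ _ _ _ (conn v w) vw.
exact: del_vertex_unbounded1 vu (ham_del v).
Qed.
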